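(* Let $A\in\mathbb{R}^{m\times n}$, $b\in\mathbb{R}^m$, $c\in\mathbb{R}^n$. Suppose that the LP $\min\{c^\top x: Ax=b,\ x\ge0\}$ has an optimal solution, and let $\mathcal{X}^\star$ be its set of optimal solutions. If $\operatorname{DistInfeas}(A,b)>0$, then $$\theta_p^\star\ \le\ \frac{\|A\|\left(1+\max_{x\in\mathcal{X}^\star}\|x\|\right)}{\operatorname{DistInfeas}(A,b)} .$$
   Context: Vector norms are Euclidean, matrix norms are the induced operator (spectral) norm, and $\operatorname{Dist}$ is Euclidean distance to a set. If $\mathcal{X}^\star$ is unbounded the maximum is read as $+\infty$. $V_p:=\{x\in\mathbb{R}^n:Ax=b\}$, $\mathcal{F}_p:=V_p\cap\mathbb{R}^n_+$. For $x\in V_p\setminus\mathcal{F}_p$, $\theta_p(x):=\operatorname{Dist}(x,\mathcal{F}_p)/\operatorname{Dist}(x,\mathbb{R}^n_+)$, and $\theta_p(x):=1$ for $x\in\mathcal{F}_p$. Limiting error ratio: $\theta_p^\star:=\lim_{\epsilon\to0}\sup\{\theta_p(x):x\in V_p,\ \operatorname{Dist}(x,\mathcal{X}^\star)\le\epsilon\}$. Distance to infeasibility: with $\operatorname{SOLN}(A,b):=\{\hat x\in\mathbb{R}^n:A\hat x=b,\ \hat x\ge0\}$, $\operatorname{DistInfeas}(A,b):=\inf\{\|\Delta A\|+\|\Delta b\|:\operatorname{SOLN}(A+\Delta A,b+\Delta b)=\emptyset\}$, where $\Delta A\in\mathbb{R}^{m\times n}$, $\Delta b\in\mathbb{R}^m$.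 *)

(* Defs.v *)
From HB Require Import structures.
From mathcomp Require Import all_boot all_order all_algebra.
From mathcomp Require Import all_classical all_reals all_analysis.
Set Implicit Arguments.
Unset Strict Implicit.
Unset Printing Implicit Defensive.
Import Order.TTheory GRing.Theory Num.Theory.
Import numFieldNormedType.Exports.
Local Open Scope classical_set_scope.
Local Open Scope ring_scope.

(* Vectors of R^n are column vectors. The library norm on matrices is the
   max-norm, hence the separate Euclidean and spectral norms below. *)
Definition enorm (R : realType) (n : nat) (x : 'cV[R]_n) : R :=
  Num.sqrt (\sum_(i < n) x i 0 ^+ 2).

Definition opnorm (R : realType) (m n : nat) (A : 'M[R]_(m, n)) : R :=
  sup [set enorm (A *m x) | x in [set x : 'cV[R]_n | enorm x <= 1]].

(* Extended-real valued, so that the distance to the empty set is +oo. *)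
Definition Dist (R : realType) (n : nat) (x : 'cV[R]_n) (S : set 'cV[R]_n)
  : \bar R := ereal_inf [set (enorm (x - y))%:E | y in S].

Definition nneg_orthant (R : realType) (n : nat) : set 'cV[R]_n :=
  [set x | forall i, 0 <= x i 0].
Arguments nneg_orthant : clear implicits.

Definition affine_space (R : realType) (m n : nat) (A : 'M[R]_(m, n))
  (b : 'cV[R]_m) : set 'cV[R]_n := [set x | A *m x = b].

Definition SOLN (R : realType) (m n : nat) (A : 'M[R]_(m, n))
  (b : 'cV[R]_m) : set 'cV[R]_n := affine_space A b `&` nneg_orthant R n.

Definition optimal_set (R : realType) (m n : nat) (A : 'M[R]_(m, n))
  (b : 'cV[R]_m) (c : 'cV[R]_n) : set 'cV[R]_n :=
  [set x | SOLN A b x /\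
     forall y, SOLN A b y -> (c^T *m x) 0 0 <= (c^T *m y) 0 0].

Definition error_ratio (R : realType) (m n : nat) (A : 'M[R]_(m, n))
  (b : 'cV[R]_m) (x : 'cV[R]_n) : \bar R :=
  (if x \in SOLN A b then 1
   else Dist x (SOLN A b) / Dist x (nneg_orthant R n))%E.

Definition error_ratio_sup (R : realType) (m n : nat) (A : 'M[R]_(m, n))
  (b : 'cV[R]_m) (c : 'cV[R]_n) (e : R) : \bar R :=
  ereal_sup [set error_ratio A b x | x in
    [set x | affine_space A b x /\ (Dist x (optimal_set A b c) <= e%:E)%E]].

Definition limiting_error_ratio (R : realType) (m n : nat) (A : 'M[R]_(m, n))
  (b : 'cV[R]_m) (c : 'cV[R]_n) : \bar R :=
  lim (error_ratio_sup A b c e @[e --> 0^'+]).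

(* [lim] is a total operator; this is the convergence that makes it meaningful
   in [limiting_error_ratio]. *)
Lemma is_cvg_error_ratio_sup (R : realType) (m n : nat) (A : 'M[R]_(m, n))
  (b : 'cV[R]_m) (c : 'cV[R]_n) :
  cvg (error_ratio_sup A b c e @[e --> 0^'+]).
Proof.
apply: (@nondecreasing_at_right_is_cvge _ _ 0).
near=> s; move=> x y _ _ xy.
apply: ereal_sup_le => _ [z [Vz Dz] <-]; exists z => //; split => //.
by apply: le_trans Dz _; rewrite lee_fin.
Unshelve. all: by end_near. Qed.

Definition DistInfeas (R : realType) (m n : nat) (A : 'M[R]_(m, n))
  (b : 'cV[R]_m) : \bar R :=
  ereal_inf [set (opnorm p.1 + enorm p.2)%:E | p in
    [set p : 'M[R]_(m, n) * 'cV[R]_m | SOLN (A + p.1) (b + p.2) = set0]].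

(* The maximum of the norm over a nonempty closed set, read as +oo when the set
   is unbounded. *)
Definition max_enorm (R : realType) (n : nat) (S : set 'cV[R]_n) : \bar R :=
  ereal_sup [set (enorm x)%:E | x in S].

(* Main.v *)
Require Import Defs.
From HB Require Import structures.
From mathcomp Require Import all_boot all_order all_algebra.
From mathcomp Require Import all_classical all_reals all_analysis.
From mathcomp Require Import ring lra.
Import Order.TTheory GRing.Theory Num.Theory.
Import numFieldNormedType.Exports.
Local Open Scope classical_set_scope.
Local Open Scope ring_scope.

(** The bound holds pointwise, before any limit is taken: if rho > 0 is the
    distance to infeasibility, x satisfies A x = b, and x^- is the componentwise
    negative part of x (so that |x^-| is the distance from x to the orthant),
    then some feasible y has

      rho |x - y| <= |x^-| |A| (1 + |x|)        ([feasible_point_near]).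

    Near the optimal set |x| is at most the maximal norm plus a small error,
    which gives the limit.

    The pointwise bound turns a point that is far from feasible into a cheap
    perturbation making the system infeasible. By Farkas, A' z = b', z >= 0 is
    infeasible as soon as some l has A'^T l <= 0 and <b', l> > 0. When
    A^T l <= w, a rank-one change of A and a change of b along l bring this
    about, whence rho |l| <= |w| + max(0, - <b, l>)
    ([DistInfeas_certificate]).

    The multiplier l comes from projecting x on the feasible set. If y is the
    projection and d = y - x, optimality says d = v + s with v = A^T l, s >= 0
    and <s, y> = 0. The cheapest choice w = v^+ would leave - <b, l> out of
    control; instead w drops from v the entries that are negative and
    active (s_i > 0). An entrywise comparison and Cauchy-Schwarz then give
    |w| |d| <= |x^-| |v| and - <b, l> = - <x, v> <= |x| |w|
    ([trimmed_multiplier]). With |v| <= |A| |l| this is the bound.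

    The existence of an exact multiplier would need Farkas' lemma in its hard
    direction. It is avoided by replacing the projection with the minimiser
    over the orthant of |z - x|^2 + k |A z - b|^2: the only remaining
    constraints are sign constraints, so the multiplier is explicit,
    l = - k (A y - b). The one relation lost, <d, v> = 0, becomes
    <d, v> = - |l|^2 / k <= 0, which is the favourable sign. Compactness as k
    grows yields a truly feasible point. *)

(** * Euclidean and operator norms *)

Definition dot {R : realType} {n : nat} (u v : 'cV[R]_n) : R := (u^T *m v) 0 0.

Lemma dotE {R : realType} {n : nat} (u v : 'cV[R]_n) :
  dot u v = \sum_i u i 0 * v i 0.
Proof. by rewrite /dot mxE; apply: eq_bigr => i _; rewrite mxE. Qed.

Lemma dotC {R : realType} {n : nat} (u v : 'cV[R]_n) : dot u v = dot v u.
Proof. by rewrite !dotE; apply: eq_bigr => i _; rewrite mulrC. Qed.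

Lemma dotDl {R : realType} {n : nat} (u v w : 'cV[R]_n) :
  dot (u + v) w = dot u w + dot v w.
Proof. by rewrite /dot linearD /= mulmxDl mxE. Qed.

Lemma dotZl {R : realType} {n : nat} a (u w : 'cV[R]_n) :
  dot (a *: u) w = a * dot u w.
Proof. by rewrite /dot linearZ /= -scalemxAl mxE. Qed.

Lemma dotNl {R : realType} {n : nat} (u w : 'cV[R]_n) : dot (- u) w = - dot u w.
Proof. by rewrite -scaleN1r dotZl mulN1r. Qed.

Lemma dotDr {R : realType} {n : nat} (u v w : 'cV[R]_n) :
  dot w (u + v) = dot w u + dot w v.
Proof. by rewrite /dot mulmxDr mxE. Qed.

Lemma dotZr {R : realType} {n : nat} a (u w : 'cV[R]_n) :
  dot w (a *: u) = a * dot w u.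
Proof. by rewrite dotC dotZl dotC. Qed.

Lemma dotNr {R : realType} {n : nat} (u w : 'cV[R]_n) : dot w (- u) = - dot w u.
Proof. by rewrite dotC dotNl dotC. Qed.

Definition dotlin := (@dotDl, @dotZl, @dotNl, @dotDr, @dotZr, @dotNr).

Lemma dot_adjoint {R : realType} {m n : nat} (A : 'M[R]_(m, n)) x l :
  dot (A *m x) l = dot x (A^T *m l).
Proof. by rewrite /dot trmx_mul mulmxA. Qed.

Lemma enorm_ge0 {R : realType} {n : nat} (x : 'cV[R]_n) : 0 <= enorm x.
Proof. exact: sqrtr_ge0. Qed.

Lemma sqr_enorm {R : realType} {n : nat} (x : 'cV[R]_n) :
  enorm x ^+ 2 = dot x x.
Proof.
rewrite sqr_sqrtr ?dotE; first by apply: eq_bigr => i _; rewrite expr2.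
by apply: sumr_ge0 => i _; exact: sqr_ge0.
Qed.

Lemma ler_enorm {R : realType} {n p : nat} (x : 'cV[R]_n) (y : 'cV[R]_p) :
  (enorm x <= enorm y) = (dot x x <= dot y y).
Proof. by rewrite -!sqr_enorm ler_pXn2r // nnegrE enorm_ge0. Qed.

Lemma enormZ {R : realType} {n : nat} a (x : 'cV[R]_n) :
  enorm (a *: x) = `|a| * enorm x.
Proof.
apply/eqP; rewrite -(@eqrXn2 _ 2) ?enorm_ge0 ?mulr_ge0 ?enorm_ge0 //.
by rewrite exprMn !sqr_enorm !dotlin real_normK ?num_real // mulrA expr2.
Qed.

Lemma enormN {R : realType} {n : nat} (x : 'cV[R]_n) : enorm (- x) = enorm x.
Proof. by rewrite -scaleN1r enormZ normrN1 mul1r. Qed.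

Lemma enorm0 {R : realType} {n : nat} : enorm (0 : 'cV[R]_n) = 0.
Proof. by rewrite -[0 in LHS](scale0r 0) enormZ normr0 mul0r. Qed.

Lemma enorm_eq0 {R : realType} {n : nat} (x : 'cV[R]_n) :
  (enorm x == 0) = (x == 0).
Proof.
apply/idP/eqP => [|->]; last by rewrite enorm0.
rewrite -sqrf_eq0 sqr_enorm dotE psumr_eq0 => [/allP x0|i _]; last first.
  by rewrite -expr2 sqr_ge0.
apply/matrixP => i j; rewrite ord1 mxE.
by have := x0 i (mem_index_enum i); rewrite mulf_eq0 orbb => /eqP.
Qed.

Lemma enorm_gt0 {R : realType} {n : nat} (x : 'cV[R]_n) :
  (0 < enorm x) = (x != 0).
Proof. by rewrite lt_neqAle eq_sym enorm_eq0 enorm_ge0 andbT. Qed.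

Lemma dot_le_enorm {R : realType} {n : nat} (u v : 'cV[R]_n) :
  dot u v <= enorm u * enorm v.
Proof.
have [->|u0] := eqVneq u 0; first by rewrite /dot trmx0 mul0mx mxE enorm0 mul0r.
have [->|v0] := eqVneq v 0; first by rewrite /dot mulmx0 mxE enorm0 mulr0.
rewrite -enorm_gt0 in u0; rewrite -enorm_gt0 in v0.
have := sqr_ge0 (enorm (enorm v *: u - enorm u *: v)).
rewrite sqr_enorm !dotlin -!sqr_enorm (dotC v u) => h.
have {}h : 0 <= (enorm u * enorm v) * (enorm u * enorm v - dot u v) by nra.
by move: h; rewrite pmulr_rge0 ?mulr_gt0 // subr_ge0.
Qed.

Lemma ler_enormD {R : realType} {n : nat} (u v : 'cV[R]_n) :
  enorm (u + v) <= enorm u + enorm v.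
Proof.
rewrite -(@ler_pXn2r _ 2) ?nnegrE ?addr_ge0 ?enorm_ge0 //.
rewrite sqr_enorm !dotlin -!sqr_enorm (dotC v u).
by have := dot_le_enorm u v; nra.
Qed.

Lemma enorm_opnorm_has_sup {R : realType} {m n : nat} (A : 'M[R]_(m, n)) :
  has_sup [set enorm (A *m x) | x in [set x : 'cV[R]_n | enorm x <= 1]].
Proof.
split; first by exists (enorm (A *m 0)), 0 => //=; rewrite enorm0.
exists (Num.sqrt (\sum_i enorm (row i A)^T ^+ 2)) => _ [x /= x1 <-].
apply: ler_wsqrtr; apply: ler_sum => i _.
have -> : (A *m x) i 0 = dot (row i A)^T x.
  by rewrite /dot trmxK -row_mul [RHS]mxE.
have h1 := dot_le_enorm (row i A)^T x.
have h2 := dot_le_enorm (- (row i A)^T) x; rewrite dotNl enormN in h2.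
have x0 := enorm_ge0 x; have r0 := enorm_ge0 (row i A)^T.
by rewrite -subr_ge0 subr_sqr mulr_ge0 //; nra.
Qed.

Lemma enorm_mulmx {R : realType} {m n : nat} (A : 'M[R]_(m, n)) x :
  enorm (A *m x) <= opnorm A * enorm x.
Proof.
have [->|x0] := eqVneq x 0; first by rewrite mulmx0 !enorm0 mulr0.
rewrite -enorm_gt0 in x0; rewrite -ler_pdivrMr //.
have -> : enorm (A *m x) / enorm x = enorm (A *m ((enorm x)^-1 *: x)).
  by rewrite -scalemxAr enormZ mulrC ger0_norm // invr_ge0 ltW.
apply: ub_le_sup; first by case: (enorm_opnorm_has_sup A).
exists ((enorm x)^-1 *: x) => //=.
by rewrite enormZ ger0_norm ?invr_ge0 ?enorm_ge0 // mulVf ?gt_eqF.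
Qed.

Lemma opnorm_ge0 {R : realType} {m n : nat} (A : 'M[R]_(m, n)) : 0 <= opnorm A.
Proof.
apply: ub_le_sup; first by case: (enorm_opnorm_has_sup A).
by exists 0 => /=; rewrite ?mulmx0 enorm0.
Qed.

Lemma opnorm_le {R : realType} {m n : nat} (A : 'M[R]_(m, n)) c :
  (forall x, enorm x <= 1 -> enorm (A *m x) <= c) -> opnorm A <= c.
Proof.
move=> Ac; apply: ge_sup; first by case: (enorm_opnorm_has_sup A).
by move=> _ [x x1 <-]; exact: Ac.
Qed.

Lemma enorm_trmx_mulmx {R : realType} {m n : nat} (A : 'M[R]_(m, n)) l :
  enorm (A^T *m l) <= opnorm A * enorm l.
Proof.
have [->|v0] := eqVneq (A^T *m l) 0.
  by rewrite enorm0 mulr_ge0 ?opnorm_ge0 ?enorm_ge0.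
rewrite -enorm_gt0 in v0; rewrite -(ler_pM2l v0) -expr2 sqr_enorm -dot_adjoint.
apply: le_trans (dot_le_enorm _ _) _.
by rewrite mulrCA mulrA ler_wpM2r ?enorm_ge0 // enorm_mulmx.
Qed.

(** * Certificates bounding the distance to infeasibility *)

(** The easy direction of Farkas' lemma: a solution z would give
    0 < <b, l> = <z, A^T l> <= 0. *)
Lemma SOLN_certificate {R : realType} {m n : nat} (A : 'M[R]_(m, n)) b
    (l : 'cV[R]_m) :
  (forall i, (A^T *m l) i 0 <= 0) -> 0 < dot b l -> SOLN A b = set0.
Proof.
move=> Al0 bl0; rewrite -subset0 => z [/= Az z0]; move: bl0.
rewrite -Az dot_adjoint dotE ltNge => /negP; apply.
by apply: sumr_le0 => i _; rewrite mulr_ge0_le0.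
Qed.

(** Replacing A by A - l w^T / |l|^2 turns A^T l into A^T l - w <= 0, and moving
    b by slightly more than t l / |l|^2 makes <b, l> positive. These changes
    have norms |w| / |l| and t / |l|, up to the slack e needed for
    strictness. *)
Lemma DistInfeas_certificate {R : realType} {m n : nat} (A : 'M[R]_(m, n)) b
    (l : 'cV[R]_m) (w : 'cV[R]_n) (t : R) :
  l != 0 -> (forall i, (A^T *m l) i 0 <= w i 0) -> - dot b l <= t -> 0 <= t ->
  (DistInfeas A b <= ((enorm w + t) / enorm l)%:E)%E.
Proof.
move=> l0 Alw blt t0; apply/lee_addgt0Pr => e e0; rewrite -EFinD.
have L0 : 0 < enorm l by rewrite enorm_gt0.
set k := (enorm l ^+ 2)^-1.
have k0 : 0 < k by rewrite invr_gt0 exprn_gt0.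
have kl : k * dot l l = 1 by rewrite -sqr_enorm mulVf // expf_neq0 // gt_eqF.
pose dA := - (k *: (l *m w^T)); pose db := (k * (t + e * enorm l)) *: l.
have -> : (enorm w + t) / enorm l + e = k * (enorm l * enorm w) + enorm db.
  rewrite enormZ ger0_norm ?mulr_ge0 ?addr_ge0 ?mulr_ge0 ?(ltW k0) ?(ltW e0)
    ?(ltW L0) //.
  by rewrite /k; field; rewrite gt_eqF.
apply: (@le_trans _ _ (opnorm dA + enorm db)%:E); last first.
  rewrite lee_fin lerD2r; apply: opnorm_le => x x1.
  have -> : dA *m x = (- (k * dot w x)) *: l.
    rewrite /dA mulNmx -scalemxAl -mulmxA [w^T *m x]mx11_scalar mul_mx_scalar.
    by rewrite scalerA scaleNr.
  rewrite enormZ normrN normrM (ger0_norm (ltW k0)) -mulrA ler_pM2l //.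
  rewrite mulrC ler_pM2l //.
  have h1 := dot_le_enorm w x.
  have h2 := dot_le_enorm (- w) x; rewrite dotNl enormN in h2.
  by have w0 := enorm_ge0 w; rewrite ler_norml; apply/andP; split; nra.
apply: ereal_inf_lbound; exists (dA, db) => //=.
apply: (@SOLN_certificate _ _ _ _ _ l).
  move=> i.
  have -> : (A + dA)^T *m l = A^T *m l - w.
    rewrite linearD /= mulmxDl; congr (_ + _).
    rewrite /dA linearN /= mulNmx linearZ /= -scalemxAl trmx_mul trmxK -mulmxA.
    rewrite [l^T *m l]mx11_scalar mul_mx_scalar scalerA.
    by have -> : (l^T *m l) 0 0 = dot l l by []; rewrite kl scale1r.
  by rewrite !mxE subr_le0; have := Alw i; rewrite mxE.
rewrite dotDl dotZl mulrAC kl mul1r.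
have : 0 < e * enorm l by rewrite mulr_gt0.
by move: blt; lra.
Qed.

(** Annihilating A along one direction l with <b, l> >= 0 suffices. This
    settles the cases where |x^-| is already the distance to a feasible point,
    in particular the points whose error ratio is 1. *)
Lemma DistInfeas_le_opnorm {R : realType} {m n : nat} (A : 'M[R]_(m, n)) b :
  (0 < m)%N -> (DistInfeas A b <= (opnorm A)%:E)%E.
Proof.
move=> m0.
have [l l0 bl] : exists2 l : 'cV[R]_m, l != 0 & 0 <= dot b l.
  have [->|b0] := eqVneq b 0; last by exists b; rewrite // -sqr_enorm sqr_ge0.
  exists (const_mx 1); last by rewrite /dot trmx0 mul0mx mxE.
  apply/eqP => /matrixP /(_ (Ordinal m0) 0); rewrite !mxE => /eqP.
  by rewrite oner_eq0.
apply: le_trans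
  (DistInfeas_certificate A b l _ 0 l0 (fun i => lexx _) _ (lexx _)) _.
  by rewrite oppr_le0.
by rewrite lee_fin addr0 ler_pdivrMr ?enorm_gt0 // enorm_trmx_mulmx.
Qed.

(** * The combinatorial core: trimming the multiplier *)

Definition neg_part {R : realType} {n : nat} (x : 'cV[R]_n) : 'cV[R]_n :=
  \col_i Num.max 0 (- x i 0).

(** Read d as y - x for a (near-)projection y of x on the feasible set and v as
    A^T l. Then d - v >= 0 is the multiplier of the sign constraints,
    complementary to y = x + d. Zeroing the negative entries of v where this
    multiplier is positive keeps w >= v, and it is cheap: the removed part r
    lives where d = - x, and G = - <r, x^-> dominates both |w|^2 and
    |d|^2 - |x^-|^2, while G <= |x^-| |r|. Multiplying the two lower bounds
    yields |w|^2 (|d|^2 - |x^-|^2) <= |x^-|^2 |r|^2, which is the second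
    conclusion because |v|^2 = |w|^2 + |r|^2. *)
Lemma trimmed_multiplier {R : realType} {n : nat} (x d v : 'cV[R]_n) :
  (forall i, v i 0 <= d i 0) -> (forall i, 0 <= x i 0 + d i 0) ->
  (forall i, (d i 0 - v i 0) * (x i 0 + d i 0) = 0) -> dot d v <= 0 ->
  exists w : 'cV[R]_n, [/\ forall i, v i 0 <= w i 0,
    enorm w * enorm d <= enorm (neg_part x) * enorm v &
    - dot x v <= enorm x * enorm w].
Proof.
move=> vd xd0 sxd dv0.
pose T i := (v i 0 < d i 0) && (v i 0 < 0).
pose w : 'cV[R]_n := \col_i (if T i then 0 else v i 0).
pose r : 'cV[R]_n := \col_i (if T i then v i 0 else 0).
have wE i : w i 0 = if T i then 0 else v i 0 by rewrite mxE.
have rE i : r i 0 = if T i then v i 0 else 0 by rewrite mxE.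
have nE i : neg_part x i 0 = Num.max 0 (- x i 0) by rewrite mxE.
have dT i : T i -> d i 0 = - x i 0.
  move=> /andP[vdi _]; have /eqP := sxd i.
  by rewrite mulf_eq0 subr_eq0 (gt_eqF vdi) /= addrC addr_eq0 => /eqP.
have dv i : d i 0 = v i 0 \/ d i 0 = - x i 0.
  have /eqP := sxd i; rewrite mulf_eq0 subr_eq0 => /orP[/eqP|]; first by left.
  by rewrite addrC addr_eq0 => /eqP; right.
exists w.
pose G := - dot r (neg_part x).
have Gr : G <= enorm (neg_part x) * enorm r.
  by rewrite /G -dotNl (le_trans (dot_le_enorm _ _)) // enormN mulrC.
(* Entrywise, w_i^2 <= - r_i x^-_i + d_i v_i; summing uses <d, v> <= 0. *)
have Gw : dot w w <= G.
  apply: (@le_trans _ _ (G + dot d v)); last by rewrite gerDl.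
  rewrite /G !dotE -sumrN -big_split /=; apply: ler_sum => i _.
  rewrite wE rE nE; case: ifPn => [Ti|nT].
    have [_ v0] := andP Ti; have := dT i Ti; have := xd0 i; move: (vd i).
    by case: (lerP 0 (- x i 0)) => ? ? ? ?; nra.
  have vdi := vd i; move: nT; rewrite negb_and -!leNgt => /orP[] h; last by nra.
  have -> : d i 0 = v i 0 by lra.
  by lra.
(* Entrywise, d_i^2 - d_i v_i <= - r_i x^-_i + (x^-_i)^2. *)
have Gd : dot d d <= G + dot (neg_part x) (neg_part x).
  apply: (@le_trans _ _ (dot d d - dot d v)); first by rewrite lerDl oppr_ge0.
  rewrite /G !dotE -!sumrN -!big_split /=; apply: ler_sum => i _.
  rewrite rE nE; have := vd i; have := xd0 i.
  case: ifPn => [Ti|]; last rewrite negb_and -!leNgt.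
    have [_ v0] := andP Ti; have := dT i Ti.
    by case: (lerP 0 (- x i 0)) => ? ? ? ?; nra.
  by case: (dv i) => dvi /orP[] h; case: (lerP 0 (- x i 0)) => ? ? ?; nra.
have vwr : dot v v = dot w w + dot r r.
  rewrite !dotE -big_split /=; apply: eq_bigr => i _.
  by rewrite wE rE; case: ifP => _; ring.
split.
- by move=> i; rewrite wE; case: ifPn => // /andP[_ /ltW].
- have n0 := enorm_ge0 (neg_part x).
  have w0 := enorm_ge0 w; have d0 := enorm_ge0 d; have r0 := enorm_ge0 r.
  move: Gw Gd vwr; rewrite -!sqr_enorm => Gw Gd vwr.
  rewrite -(@ler_pXn2r _ 2) ?nnegrE ?mulr_ge0 ?enorm_ge0 // !exprMn vwr.
  set W := enorm w ^+ 2 in Gw vwr *.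
  have W0 : 0 <= W by rewrite sqr_ge0.
  have GG : G ^+ 2 <= enorm (neg_part x) ^+ 2 * enorm r ^+ 2.
    by rewrite -exprMn ler_pXn2r ?nnegrE ?mulr_ge0 // (le_trans W0).
  apply: (@le_trans _ _ (W * G + W * enorm (neg_part x) ^+ 2)).
    by rewrite -mulrDr ler_wpM2l.
  apply: (@le_trans _ _ (G ^+ 2 + W * enorm (neg_part x) ^+ 2)).
    by rewrite lerD2r expr2 ler_wpM2r // (le_trans W0).
  by rewrite mulrDr [X in _ <= X + _]mulrC addrC lerD2l.
(* Entrywise, - d_i v_i <= x_i v_i - x_i w_i: on the trimmed entries d = - x,
   and on the others w = v and d_i v_i >= 0. *)
- apply: (@le_trans _ _ (- dot x w)); last first.
    by rewrite -dotNl (le_trans (dot_le_enorm _ _)) // enormN.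
  rewrite -subr_ge0.
  apply: le_trans (_ : 0 <= - dot d v) _; first by rewrite oppr_ge0.
  rewrite !dotE -!sumrN -!big_split /=; apply: ler_sum => i _.
  rewrite wE; case: ifPn => [Ti|nT]; first by rewrite (dT i Ti); lra.
  have vdi := vd i; move: nT; rewrite negb_and -!leNgt => /orP[] h; nra.
Qed.

(** * Penalised projection onto the feasible set *)

(** The domain consists of row vectors because boxes are shown compact as
    products of segments of row entries ([rV_compact]); transposes lead back to
    columns. *)
Lemma continuous_sqr_affine {R : realType} {m n : nat} (C : 'M[R]_(m, n)) e :
  continuous (fun v : 'rV[R]_n => dot (C *m v^T - e) (C *m v^T - e)).
Proof.
have -> : (fun v : 'rV[R]_n => dot (C *m v^T - e) (C *m v^T - e)) =
    fun v => \sum_i (\sum_j C i j * v 0 j - e i 0) *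
                   (\sum_j C i j * v 0 j - e i 0).
  apply/funext => u; rewrite dotE; apply: eq_bigr => i _.
  suff -> : (C *m u^T - e) i 0 = \sum_j C i j * u 0 j - e i 0 by [].
  by rewrite !mxE; congr (_ - _); apply: eq_bigr => j _; rewrite mxE.
apply: continuous_big => [|i _ v]; first exact: add_continuous.
have h : {for v, continuous (fun u : 'rV[R]_n =>
    \sum_j C i j * u 0 j - e i 0)}.
  apply: (@continuousB _ _ _ (fun u : 'rV[R]_n => \sum_j C i j * u 0 j));
    last exact: cst_continuous.
  apply: (@continuous_big _ _ +%R 0 xpredT add_continuous _ _
    (fun j (u : 'rV[R]_n) => C i j * u 0 j)) => j _ u.
  by apply: continuousM; [exact: cst_continuous | exact: coord_continuous].
exact: (continuousM h h).
Qed.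

Lemma compact_orthant_ball {R : realType} {n : nat} (x : 'cV[R]_n) (r : R) :
  compact [set v : 'rV[R]_n | nneg_orthant R n v^T /\
                              dot (v^T - x) (v^T - x) <= r].
Proof.
apply: (@subclosed_compact _ _
    [set v : 'rV[R]_n | forall i, `[0, `|x i 0| + r + 1]%classic (v ord0 i)]).
- rewrite (_ : mkset _ =
      (\bigcap_(i in [set: 'I_n]) [set v : 'rV[R]_n | 0 <= v 0 i]) `&`
      [set v | dot (1%:M *m v^T - x) (1%:M *m v^T - x) <= r]); last first.
    apply/seteqP; split => v /=; rewrite mul1mx => -[v0 vx]; split => //.
      by move=> i _; have := v0 i; rewrite mxE.
    by move=> i; rewrite mxE; exact: v0.
  apply: closedI.
    apply: closed_bigI => i _.
    apply: (@closed_comp _ _ (fun v : 'rV[R]_n => v 0 i) [set t | 0 <= t]).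
      by move=> v _; exact: coord_continuous.
    exact: closed_ge.
  apply: (@closed_comp _ _ _ [set t | t <= r]); last exact: closed_le.
  by move=> v _; exact: continuous_sqr_affine.
- apply: (@rV_compact _ n (fun i => `[0, `|x i 0| + r + 1]%classic)) => i.
  exact: segment_compact.
- move=> v [v0 vx] i; rewrite /= in_itv /=.
  have := v0 i; rewrite mxE => -> /=.
  have : (v 0 i - x i 0) ^+ 2 <= r.
    apply: le_trans vx; rewrite dotE (bigD1 i) //= !mxE -expr2 lerDl.
    by apply: sumr_ge0 => j _; rewrite -expr2 sqr_ge0.
  have := ler_norm (x i 0); have := sqr_ge0 (v 0 i - x i 0 - 1).
  have := sqr_ge0 (v 0 i - x i 0); rewrite -[ord0]/(0 : 'I_1).
  set a := v 0 i; set c := x i 0; nra.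
Qed.

Lemma orthant_ball_min {R : realType} {n : nat} (x z0 : 'cV[R]_n) (r : R)
    (f : 'cV[R]_n -> R) :
  continuous (fun v : 'rV[R]_n => f v^T) ->
  nneg_orthant R n z0 -> dot (z0 - x) (z0 - x) <= r ->
  exists y, [/\ nneg_orthant R n y, dot (y - x) (y - x) <= r &
    forall z, nneg_orthant R n z -> dot (z - x) (z - x) <= r -> f y <= f z].
Proof.
move=> fc z00 z0r.
have [|v /[!inE] -[v0 vr] vmin] := compact_EVT_min _ (compact_orthant_ball x r)
    (continuous_subspaceT fc).
  by exists z0^T => /=; rewrite trmxK.
exists v^T; split => // z zz zr.
by have := vmin z^T; rewrite trmxK; apply; rewrite inE /= trmxK.
Qed.

Definition penalty {R : realType} {m n : nat} (A : 'M[R]_(m, n)) b x k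
    (z : 'cV[R]_n) : R :=
  dot (z - x) (z - x) + k * dot (A *m z - b) (A *m z - b).

(** The origin lies in the orthant, and points of the orthant further from x
    than the square root of its penalty do worse than it; so a minimiser over
    the corresponding compact piece is global. *)
Lemma penalty_min {R : realType} {m n : nat} (A : 'M[R]_(m, n)) b x k :
  0 <= k -> exists2 y, nneg_orthant R n y &
    forall z, nneg_orthant R n z -> penalty A b x k y <= penalty A b x k z.
Proof.
move=> k0.
have dot_ge0 p (u : 'cV[R]_p) : 0 <= dot u u by rewrite -sqr_enorm sqr_ge0.
have o0 : nneg_orthant R n 0 by move=> i; rewrite mxE.
have r0 : dot (0 - x) (0 - x) <= penalty A b x k 0.
  by rewrite lerDl mulr_ge0.
have [|y [y0 yr ymin]] := orthant_ball_min x 0 _ (penalty A b x k) _ o0 r0.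
  have -> : (fun v : 'rV[R]_n => penalty A b x k v^T) = fun v =>
      dot (1%:M *m v^T - x) (1%:M *m v^T - x)
      + k * dot (A *m v^T - b) (A *m v^T - b).
    by apply/funext => v; rewrite mul1mx.
  move=> v.
  have cA := continuous_sqr_affine A b v.
  have ck : {for v, continuous (cst k : 'rV[R]_n -> R)} by exact: cst_continuous.
  exact: (continuousD (continuous_sqr_affine 1%:M x v) (continuousM ck cA)).
exists y => // z z0.
have [zr|zr] := leP (dot (z - x) (z - x)) (penalty A b x k 0).
  exact: ymin.
apply: le_trans (ymin _ o0 r0) _; apply: le_trans (ltW zr) _.
by rewrite lerDl mulr_ge0.
Qed.

(** Moving y along one coordinate by t changes the penalty by
    2 t g_i + t^2 c with c > 0. It cannot decrease for the admissible t, that is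
    t >= - y_i: a negative g_i would be contradicted by t = - g_i / c, and a
    positive g_i with y_i > 0 by a small negative t. *)
Lemma penalty_KKT {R : realType} {m n : nat} (A : 'M[R]_(m, n)) b x k y
    (g := y - x + k *: (A^T *m (A *m y - b))) :
  0 <= k -> nneg_orthant R n y ->
  (forall z, nneg_orthant R n z -> penalty A b x k y <= penalty A b x k z) ->
  forall i, 0 <= g i 0 /\ g i 0 * y i 0 = 0.
Proof.
move=> k0 y0 ymin i.
pose e : 'cV[R]_n := delta_mx i 0.
have dote u : dot u e = u i 0.
  rewrite dotE (bigD1 i) //= big1 => [|j ji].
    by rewrite mxE !eqxx mulr1 addr0.
  by rewrite mxE (negbTE ji) mulr0.
pose c := 1 + k * dot (A *m e) (A *m e).
have c1 : 1 <= c by rewrite lerDl mulr_ge0 // -sqr_enorm sqr_ge0.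
have quad t : penalty A b x k (y + t *: e) =
    penalty A b x k y + 2 * t * g i 0 + t ^+ 2 * c.
  have -> : g i 0 = dot (y - x) e + k * dot (A *m y - b) (A *m e).
    rewrite -dote dotDl dotZl [dot (_ *m _) e]dotC -dot_adjoint.
    by rewrite [dot (A *m e) _]dotC.
  rewrite /penalty mulmxDr -scalemxAr ![_ + _ *: _ - _]addrAC.
  have ee : dot e e = 1 by rewrite dote mxE !eqxx.
  rewrite /c; move: (y - x) (A *m y - b) (A *m e) => u w a.
  by rewrite !dotlin ee (dotC e u) (dotC a w); ring.
have main t : 0 <= y i 0 + t -> 0 <= 2 * t * g i 0 + t ^+ 2 * c.
  move=> yt; have : penalty A b x k y <= penalty A b x k (y + t *: e).
    apply: ymin => j; rewrite !mxE eqxx andbT.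
    by case: eqP => [->|_]; rewrite ?mulr1 ?mulr0 ?addr0.
  by rewrite quad -addrA lerDl.
have yi := y0 i; set gi := g i 0 in main *; set yi' := y i 0 in main yi *.
have cp : 0 < c by lra.
have gi0 : 0 <= gi.
  rewrite leNgt; apply/negP => gneg.
  have /main : 0 <= yi' + (- gi / c).
    by rewrite addr_ge0 // divr_ge0 ?oppr_ge0 ?ltW.
  have -> : 2 * (- gi / c) * gi + (- gi / c) ^+ 2 * c = - (gi ^+ 2 / c).
    by field; rewrite gt_eqF.
  by rewrite oppr_ge0 leNgt divr_gt0 // exprn_even_gt0 //= lt_eqF.
split => //; apply/eqP; rewrite mulf_eq0 -[_ || _]negbK negb_or.
apply/negP => /andP[g0 yn0].
have gp : 0 < gi by rewrite lt_neqAle eq_sym g0.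
have yp : 0 < yi' by rewrite lt_neqAle eq_sym yn0.
pose t := Num.min yi' (gi / c).
have tp : 0 < t by rewrite lt_min yp divr_gt0.
have ty : t <= yi' by rewrite ge_min lexx.
have tg : t * c <= gi by rewrite -ler_pdivlMr // ge_min lexx orbT.
have /main : 0 <= yi' - t by rewrite subr_ge0.
nra.
Qed.

(** * Distance to the feasible set *)

(** The target inequality for the minimiser y of the penalty. The multiplier is
    l = - k (A y - b); for v = A^T l and d = y - x one gets
    <d, v> = <A y - b, l> <= 0, as trimming requires. *)
Lemma penalized_point_bound {R : realType} {m n : nat} (A : 'M[R]_(m, n))
    (b : 'cV[R]_m) (x f : 'cV[R]_n) (rho k : R) :
  (0 < m)%N -> DistInfeas A b = rho%:E -> 0 <= rho -> 0 < k ->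
  A *m x = b -> SOLN A b f ->
  exists y, [/\ nneg_orthant R n y,
    rho * enorm (y - x) <= enorm (neg_part x) * (opnorm A * (1 + enorm x)) &
    k * dot (A *m y - b) (A *m y - b) <= dot (f - x) (f - x)].
Proof.
move=> m0 Drho rho0 k0 Ax [/= Af f0].
have [y y0 ymin] := penalty_min A b x k (ltW k0).
have kkt := penalty_KKT A b x k y (ltW k0) y0 ymin.
exists y; split => //; last first.
  have := ymin f f0; rewrite /penalty Af subrr [dot 0 0]dotE big1 => [|i _].
    rewrite mulr0 addr0; apply: le_trans; rewrite lerDr.
    by rewrite -sqr_enorm sqr_ge0.
  by rewrite mxE mulr0.
have A0 := opnorm_ge0 A; have x0 := enorm_ge0 x.
have n0 := enorm_ge0 (neg_part x).
pose d := y - x; rewrite -/d; have d0 := enorm_ge0 d.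
have xd i : x i 0 + d i 0 = y i 0 by rewrite !mxE; ring.
have rhoA : rho <= opnorm A by rewrite -lee_fin -Drho DistInfeas_le_opnorm.
pose l := - k *: (A *m y - b).
have gE i : (y - x + k *: (A^T *m (A *m y - b))) i 0 = d i 0 - (A^T *m l) i 0.
  have -> : y - x + k *: (A^T *m (A *m y - b)) = d - A^T *m l.
    by rewrite /l -scalemxAr scaleNr opprK.
  by rewrite [LHS]mxE; congr (_ + _); rewrite [LHS]mxE.
have [l0|l0] := eqVneq l 0.
  (* Here y is the projection of x on the orthant, so |d| <= |x^-|. *)
  have ddn : dot d d <= dot d (neg_part x).
    rewrite !dotE; apply: ler_sum => i _.
    have [] := kkt i; rewrite gE l0 mulmx0 [(0 : 'cV__) i 0]mxE subr0 -xd.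
    rewrite [neg_part x i 0]mxE; set di := d i 0; set xi := x i 0.
    by case: (lerP 0 (- xi)) => ? ? ?; nra.
  have dn : enorm d <= enorm (neg_part x).
    have := le_trans ddn (dot_le_enorm _ _); rewrite -sqr_enorm expr2.
    have [->//|dn0] := eqVneq (enorm d) 0.
    by rewrite ler_pM2l // lt_neqAle eq_sym dn0.
  rewrite mulrC ler_pM //; apply: le_trans rhoA _.
  by rewrite ler_peMr // lerDl.
have [i|i|i||w [vw wd xv]] := trimmed_multiplier x d (A^T *m l).
- by have [] := kkt i; rewrite gE subr_ge0.
- by rewrite xd; exact: y0.
- by have [_ gy] := kkt i; rewrite -gE xd.
- rewrite -dot_adjoint mulmxBr Ax dotZr mulNr oppr_le0 mulr_ge0 ?(ltW k0) //.
  by rewrite -sqr_enorm sqr_ge0.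
have lp : 0 < enorm l by rewrite enorm_gt0.
have w0 := enorm_ge0 w.
have := DistInfeas_certificate A b l w (enorm x * enorm w) l0 vw.
rewrite -{1}Ax dot_adjoint mulr_ge0 // => /(_ xv isT).
rewrite Drho lee_fin ler_pdivlMr // => cert.
have vl := enorm_trmx_mulmx A l.
rewrite -(ler_pM2r lp) mulrAC.
apply: (@le_trans _ _ ((enorm w * enorm d) * (1 + enorm x))).
  by rewrite [leRHS]mulrAC ler_wpM2r // mulrDr mulr1 [enorm w * enorm x]mulrC.
apply: (@le_trans _ _ ((enorm (neg_part x) * enorm (A^T *m l)) * (1 + enorm x))).
  by rewrite ler_wpM2r // addr_ge0.
have -> : enorm (neg_part x) * (opnorm A * (1 + enorm x)) * enorm l =
  enorm (neg_part x) * (opnorm A * enorm l) * (1 + enorm x) by ring.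
by rewrite ler_wpM2r ?addr_ge0 // ler_wpM2l.
Qed.

(** The residual attains its minimum over the orthant points satisfying the
    distance bound, and for every k that minimum is at most |f - x|^2 / k; hence
    it vanishes. *)
Lemma feasible_point_near {R : realType} {m n : nat} (A : 'M[R]_(m, n))
    (b : 'cV[R]_m) (x f : 'cV[R]_n) (rho : R) :
  (0 < m)%N -> DistInfeas A b = rho%:E -> 0 < rho ->
  A *m x = b -> SOLN A b f ->
  exists2 y, SOLN A b y &
    rho * enorm (x - y) <= enorm (neg_part x) * (opnorm A * (1 + enorm x)).
Proof.
move=> m0 Drho rho0 Ax fS.
set B := _ * _.
have B0 : 0 <= B / rho.
  by rewrite divr_ge0 ?mulr_ge0 ?addr_ge0 ?enorm_ge0 ?opnorm_ge0 // ltW.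
pose res z := dot (A *m z - b) (A *m z - b).
have res0 z : 0 <= res z by rewrite /res -sqr_enorm sqr_ge0.
have ball z :
    (dot (z - x) (z - x) <= (B / rho) ^+ 2) = (rho * enorm (z - x) <= B).
  rewrite -sqr_enorm ler_pXn2r ?nnegrE ?enorm_ge0 //.
  by rewrite ler_pdivlMr // mulrC.
have step := penalized_point_bound A b x f rho _ m0 Drho (ltW rho0) _ Ax fS.
have [z1 [z10 z1B _]] := step 1 ltr01.
have [||y [y0 yB ymin]] := orthant_ball_min x z1 ((B / rho) ^+ 2) res _ z10.
- exact: continuous_sqr_affine.
- by rewrite ball.
exists y; last by rewrite -enormN opprB -ball.
split => //=; apply/eqP.
rewrite -subr_eq0 -enorm_eq0 -sqrf_eq0 sqr_enorm -/(res y).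
rewrite eq_le res0 andbT leNgt; apply/negP => resy.
set C := dot (f - x) (f - x) in step *.
have C0 : 0 <= C by rewrite /C -sqr_enorm sqr_ge0.
(* With this weight the penalised point would have a residual smaller than that
   of y. *)
have kp : 0 < (C + 1) / res y by rewrite divr_gt0 // ltr_wpDl.
have [z [z0 zB zC]] := step _ kp.
have := ymin z z0; rewrite ball => /(_ zB) yz.
have : (C + 1) / res y * res y <= C.
  by apply: le_trans zC; rewrite ler_wpM2l // ltW.
by rewrite divfK ?gt_eqF //; lra.
Qed.

(** * The error ratio and its limit *)

Lemma Dist_orthant_ge {R : realType} {n : nat} (x : 'cV[R]_n) :
  ((enorm (neg_part x))%:E <= Dist x (nneg_orthant R n))%E.
Proof.
apply: le_ereal_inf_tmp => _ [y y0 <-]; rewrite lee_fin ler_enorm !dotE.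
apply: ler_sum => i _; have := y0 i.
rewrite [neg_part x i 0]mxE.
have -> : (x - y) i 0 = x i 0 - y i 0 by rewrite !mxE.
have := sqr_ge0 (x i 0 - y i 0).
by case: (lerP 0 (- x i 0)) => ? ? ?; nra.
Qed.

(** The pointwise form of the theorem, valid on the whole affine space
    and not only near the optimal set. *)
Lemma error_ratio_bound {R : realType} {m n : nat} (A : 'M[R]_(m, n))
    (b : 'cV[R]_m) (x f : 'cV[R]_n) (rho : R) :
  (0 < m)%N -> DistInfeas A b = rho%:E -> 0 < rho ->
  A *m x = b -> SOLN A b f ->
  (error_ratio A b x <= (opnorm A * (1 + enorm x) / rho)%:E)%E.
Proof.
move=> m0 Drho rho0 Ax fS; rewrite /error_ratio; case: ifPn => xS.
  rewrite lee_fin ler_pdivlMr // mul1r.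
  apply: (@le_trans _ _ (opnorm A)); last first.
    by rewrite ler_peMr ?opnorm_ge0 // lerDl enorm_ge0.
  by rewrite -lee_fin -Drho DistInfeas_le_opnorm.
have [y yS yB] := feasible_point_near A b x f rho m0 Drho rho0 Ax fS.
have npos : 0 < enorm (neg_part x).
  rewrite enorm_gt0; apply: contra xS => /eqP n0; rewrite inE; split => //= i.
  have : neg_part x i 0 = 0 by rewrite n0 mxE.
  by rewrite mxE; case: (lerP 0 (- x i 0)) => ? ?; lra.
have orth := Dist_orthant_ge x.
have ofin : (Dist x (nneg_orthant R n) < +oo)%E.
  apply: (@le_lt_trans _ _ (enorm (x - 0))%:E); last exact: ltry.
  by apply: ereal_inf_lbound; exists 0 => // i; rewrite mxE.
have feas : (Dist x (SOLN A b) <= (enorm (x - y))%:E)%E.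
  by apply: ereal_inf_lbound; exists y.
move: orth ofin; case: (Dist x (nneg_orthant R n)) => [t| |];
  rewrite ?leeNy_eq //.
rewrite lee_fin => nt _; have tpos : 0 < t := lt_le_trans npos nt.
rewrite inver gt_eqF // lee_pdivrMr //; apply: le_trans feas _.
rewrite -EFinM lee_fin mulrAC ler_pdivlMr // mulrC; apply: le_trans yB _.
by rewrite mulrC ler_wpM2l // mulr_ge0 ?opnorm_ge0 // addr_ge0 ?enorm_ge0.
Qed.

Lemma enorm_le_Dist {R : realType} {n : nat} (x : 'cV[R]_n) S (M e : R) :
  (max_enorm S <= M%:E)%E -> (Dist x S <= e%:E)%E -> enorm x <= M + e.
Proof.
move=> SM De; apply/ler_addgt0Pr => d d0.
have /ereal_inf_lt[_ [y yS <-]] : (Dist x S < (e + d)%:E)%E.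
  by apply: le_lt_trans De _; rewrite lte_fin ltrDl.
rewrite lte_fin => xy.
have yM : enorm y <= M.
  by rewrite -lee_fin; apply: le_trans SM; apply: ereal_sup_ubound; exists y.
by have := ler_enormD y (x - y); rewrite addrC subrK; lra.
Qed.

Theorem corollary4p4 (R : realType) (m n : nat) (hm : (0 < m)%N)
  (A : 'M[R]_(m, n)) (b : 'cV[R]_m) (c : 'cV[R]_n)
  (hopt : optimal_set A b c !=set0)
  (hdist : (0 < DistInfeas A b)%E) :
  (limiting_error_ratio A b c <=
     ((opnorm A)%:E * (1 + max_enorm (optimal_set A b c))) / DistInfeas A b)%E.
Proof.
have rhoA := DistInfeas_le_opnorm A b hm.
have [f [fS fopt]] := hopt.
have [rho Drho] : exists rho, DistInfeas A b = rho%:E.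
  exists (fine (DistInfeas A b)).
  by rewrite fineK // gt0_fin_numE // (le_lt_trans rhoA) // ltry.
rewrite Drho lte_fin in hdist; rewrite Drho lee_fin in rhoA.
have A0 : 0 < opnorm A := lt_le_trans hdist rhoA.
rewrite Drho inver gt_eqF //.
have M0 : (0 <= max_enorm (optimal_set A b c))%E.
  apply: (@le_trans _ _ (enorm f)%:E); first by rewrite lee_fin enorm_ge0.
  by apply: ereal_sup_ubound; exists f.
have [Minf|Mfin] := eqVneq (max_enorm (optimal_set A b c)) +oo%E.
  rewrite Minf addey // gt0_muley ?lte_fin // gt0_mulye ?lte_fin ?invr_gt0 //.
  exact: leey.
have [M ME] : exists M, max_enorm (optimal_set A b c) = M%:E.
  exists (fine (max_enorm (optimal_set A b c))).
  by rewrite fineK // ge0_fin_numE // ltey.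
rewrite ME -EFinD -!EFinM.
have supB e : 0 < e ->
    (error_ratio_sup A b c e <= (opnorm A * (1 + (M + e)) / rho)%:E)%E.
  move=> e0; apply: ge_ereal_sup => _ [x [Vx Dx] <-].
  apply: le_trans (error_ratio_bound A b x f rho hm Drho hdist Vx fS) _.
  rewrite lee_fin ler_pM2r ?invr_gt0 // ler_pM2l // lerD2l.
  by apply: enorm_le_Dist Dx; rewrite ME.
apply/lee_addgt0Pr => d d0; apply: lime_le; first exact: is_cvg_error_ratio_sup.
(* For e up to this value the bound at e exceeds its limit by at most d. *)
have e0 : 0 < d * rho / opnorm A by rewrite divr_gt0 // mulr_gt0.
near=> e.
have ep : 0 < e by near: e; exact: nbhs_right_gt.
apply: le_trans (supB e ep) _; rewrite -EFinD lee_fin.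
have -> : opnorm A * (1 + M) / rho + d =
    opnorm A * (1 + (M + d * rho / opnorm A)) / rho.
  by field; rewrite !gt_eqF.
rewrite ler_pM2r ?invr_gt0 // ler_pM2l // !lerD2l.
by near: e; exact: nbhs_right_le.
Unshelve. all: by end_near. Qed.
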